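(* Let $H^+_d(q_k,p_{k+1})$ be the stochastic discrete Hamiltonian on the time step $[t_k,t_{k+1}]$ defined in the context, and let $F^+_{t_{k+1},t_k}:\Omega\times T^*Q\to T^*Q$ be the discrete stochastic flow $(q_k,p_k)\mapsto(q_{k+1},p_{k+1})$ implicitly defined by $$q_{k+1}=D_2H^+_d(q_k,p_{k+1}),\qquad p_k=D_1H^+_d(q_k,p_{k+1}).$$ Then $F^+_{t_{k+1},t_k}$ is almost surely symplectic, that is, $$(F^+_{t_{k+1},t_k})^*\Omega_{T^*Q}=\Omega_{T^*Q},$$ where $\Omega_{T^*Q}=\sum_{i=1}^N dq^i\wedge dp^i$ is the canonical symplectic form on $T^*Q$.
   Context: $Q\cong\mathbb{R}^N$, $T^*Q=Q\times Q^*\cong\mathbb{R}^N\times\mathbb{R}^N$ with canonical coordinates $(q,p)$; products such as $p\,q$ denote the scalar product. $W(t)$ is a standard one-dimensional Wiener process on a filtered probability space $(\Omega,\mathcal{F},\mathbb{P})$; $t_k=k\Delta t$, $\Delta t>0$, and $\Delta W=W(t_{k+1})-W(t_k)$. The Hamiltonians $H,h:T^*Q\to\mathbb{R}$ (time-independent) are $C^2$, and the coefficients $A,B$ of the It\^o form $dz=A(z)dt+B(z)dW(t)$, $z=(q,p)$, of the stochastic Hamiltonian system $dq=\frac{\partial H}{\partial p}dt+\frac{\partial h}{\partial p}\circ dW(t)$, $dp=-\frac{\partial H}{\partial q}dt-\frac{\partial h}{\partial q}\circ dW(t)$ (with $\circ$ denoting Stratonovich integration) are globally Lipschitz. Discretization: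 let $s\ge1$, control points $0=d_0<d_1<\dots<d_s=1$, and let $l_{\mu,s}(\tau)$ be the corresponding Lagrange polynomials of degree $s$, $l_{\mu,s}(d_\nu)=\delta_{\mu\nu}$. For control values $q^0,\dots,q^s\in Q$ put $$q_d(t_k+\tau\Delta t;q^\mu)=\sum_{\mu=0}^sq^\mu l_{\mu,s}(\tau),\qquad \dot q_d(t_k+\tau\Delta t;q^\mu)=\frac1{\Delta t}\sum_{\mu=0}^sq^\mu\dot l_{\mu,s}(\tau).$$ Let $(\alpha_i,c_i)_{i=1}^r$ and $(\beta_i,c_i)_{i=1}^r$ be quadrature rules with points $0\le c_1<\dots<c_r\le1$ and weights $\alpha_i$, $\beta_i$, where for each $i$ we have $\alpha_i\ne0$ or $\beta_i\ne0$. The discrete Hamiltonian is $$H^+_d(q_k,p_{k+1})=\mathop{\mathrm{ext}}_{\substack{q^1,\dots,q^s\in Q \\ P_1,\dots,P_r\in Q^* \\ q^0=q_k}}\Big\{p_{k+1}q^s-\Delta t\sum_{i=1}^r\alpha_i\big[P_i\,\dot q_d(t_k+c_i\Delta t)-H\big(q_d(t_k+c_i\Delta t),P_i\big)\big]+\Delta W\sum_{i=1}^r\beta_i\,h\big(q_d(t_k+c_i\Delta t),P_i\big)\Big\},$$ where $\mathrm{ext}$ denotes the extremal (stationary) value with respect to the indicated variables, taken pointwise in $\Omega$. $D_1,D_2$ denote derivatives with respect to the first and second argument. *)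

(* Defs.v *)
From HB Require Import structures.
From mathcomp Require Import all_boot all_order all_algebra.
From mathcomp Require Import all_classical all_reals all_analysis.

Set Implicit Arguments.
Unset Strict Implicit.
Unset Printing Implicit Defensive.

Import Order.TTheory GRing.Theory Num.Theory.
Import numFieldNormedType.Exports.

Local Open Scope classical_set_scope.
Local Open Scope ring_scope.

(* Both T*Q = Q x Q^* (points (q, p)) and the arguments (q_k, p_{k+1}) of the
   discrete Hamiltonian live in this type; covectors are written as row
   vectors through the scalar product. *)
Notation phase R N := ('rV[R]_N * 'rV[R]_N)%type.

Section Calculus.
Context {R : realType}.

(* On a finite-dimensional V, which is the only use made of it, continuity of
   every x |-> 'D_v f x amounts to continuity of the differential. *)
Definition C1 (V W : normedModType R) (f : V -> W) : Prop :=
  (forall x, differentiable f x) /\ (forall v, continuous ('D_v f)).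

Definition C2 (V W : normedModType R) (f : V -> W) : Prop :=
  C1 f /\ (forall v, C1 ('D_v f)).

Definition dot N (u v : 'rV[R]_N) : R := \sum_(i < N) u ord0 i * v ord0 i.

Definition grad N (f : 'rV[R]_N -> R) (x : 'rV[R]_N) : 'rV[R]_N :=
  \row_(i < N) 'D_(delta_mx ord0 i) f x.

Definition D1 N (f : phase R N -> R) (z : phase R N) : 'rV[R]_N :=
  grad (fun q => f (q, z.2)) z.1.

Definition D2 N (f : phase R N -> R) (z : phase R N) : 'rV[R]_N :=
  grad (fun p => f (z.1, p)) z.2.

(* v is an extremal (stationary) value of f.  A relation, as a function may
   have no stationary value, or several. *)
Definition ext_value (V : normedModType R) (f : V -> R) (v : R) : Prop :=
  exists y : V, is_diff y f (fun _ => 0) /\ f y = v.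

End Calculus.

Section Wiener.
Context {R : realType} {d : measure_display} {T : measurableType d}.

(* Time is [0, +oo[; the values of Filt and W at negative times are junk. *)
Definition filtration (Filt : R -> set (set T)) : Prop :=
  [/\ forall t, 0 <= t -> sigma_algebra setT (Filt t),
      forall t A, 0 <= t -> Filt t A -> measurable A
    & forall s t, 0 <= s -> s <= t -> Filt s `<=` Filt t].

Definition adapted (Filt : R -> set (set T)) (W : R -> T -> R) : Prop :=
  forall t (B : set (measurableTypeR R)), 0 <= t -> measurable B ->
    Filt t (W t @^-1` B).

Definition increment (W : R -> T -> R) (s t : R) (w : T) : R := W t w - W s w.

(* The second parameter of normal_prob is the standard deviation. *)
Definition wiener (P : probability T R) (Filt : R -> set (set T))
    (W : R -> T -> R) : Prop :=
  [/\ filtration Filt /\ adapted Filt W,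
      \forall w \ae P, W 0 w = 0,
      forall s t (A : set T) (B : set (measurableTypeR R)),
        0 <= s -> s <= t -> Filt s A -> measurable B ->
        P (A `&` increment W s t @^-1` B) =
        (P A * P (increment W s t @^-1` B))%E,
      forall s t (B : set (measurableTypeR R)),
        0 <= s -> s < t -> measurable B ->
        P (increment W s t @^-1` B) =
        normal_prob 0 (Num.sqrt (t - s)) B
    & \forall w \ae P, {within `[0, +oo[, continuous (fun t => W t w)}].

End Wiener.

Section StochasticHamiltonianSystem.
Context {R : realType} {N : nat}.

Definition ham_field (f : phase R N -> R) (z : phase R N) : phase R N :=
  (D2 f z, - D1 f z).

Definition ito_diffusion (h : phase R N -> R) : phase R N -> phase R N :=
  ham_field h.

(* dz = X_H dt + X_h o dW (Stratonovich) is dz = A dt + B dW (Ito) with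
   B = X_h and A = X_H + (1/2) (D X_h) X_h. *)
Definition ito_drift (H h : phase R N -> R) (z : phase R N) : phase R N :=
  ham_field H z +
  (2^-1 : R) *: 'D_(ito_diffusion h z) (ito_diffusion h) z.

End StochasticHamiltonianSystem.

Section DiscreteHamiltonian.
Context {R : realType} {N : nat}.

Definition lagrange_poly s (c : 'I_s.+1 -> R) (mu : 'I_s.+1) : {poly R} :=
  \prod_(nu < s.+1 | nu != mu) ((c mu - c nu)^-1 *: ('X - (c nu)%:P)).

(* The value at t_k + tau dt of the interpolant of the control values
   q^0, ..., q^s (the rows of qs), and of its time derivative. *)
Definition qd s (c : 'I_s.+1 -> R) (qs : 'M[R]_(s.+1, N)) (tau : R)
    : 'rV[R]_N :=
  \sum_(mu < s.+1) (lagrange_poly c mu).[tau] *: row mu qs.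

Definition qd_dot s (c : 'I_s.+1 -> R) (dt : R) (qs : 'M[R]_(s.+1, N))
    (tau : R) : 'rV[R]_N :=
  dt^-1 *: \sum_(mu < s.+1) ((lagrange_poly c mu)^`()).[tau] *: row mu qs.

(* The expression to be extremised, as a function of y = (q^1..q^s, P_1..P_r);
   col_mx puts q^0 = q_k on top of the rows q^1, ..., q^s. *)
Definition discrete_action (H h : phase R N -> R) s (cp : 'I_s.+1 -> R) r
    (alpha beta c : 'I_r -> R) (dt dW : R) (x : phase R N)
    (y : 'M[R]_(s, N) * 'M[R]_(r, N)) : R :=
  let qs : 'M[R]_(s.+1, N) := col_mx x.1 y.1 in
  dot x.2 (row ord_max qs)
  - dt * (\sum_(i < r) alpha i *
            (dot (row i y.2) (qd_dot cp dt qs (c i))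
             - H (qd cp qs (c i), row i y.2)))
  + dW * (\sum_(i < r) beta i * h (qd cp qs (c i), row i y.2)).

(* x = (q_k, p_{k+1}) *)
Definition is_discrete_hamiltonian (H h : phase R N -> R) s
    (cp : 'I_s.+1 -> R) r (alpha beta c : 'I_r -> R) (dt dW : R)
    (Hd : phase R N -> R) : Prop :=
  forall x, ext_value (discrete_action H h cp alpha beta c dt dW x) (Hd x).

(* z = (q_k, p_k) and F z = (q_{k+1}, p_{k+1}) *)
Definition is_discrete_flow (Hd : phase R N -> R)
    (F : phase R N -> phase R N) : Prop :=
  forall z, (F z).1 = D2 Hd (z.1, (F z).2) /\ z.2 = D1 Hd (z.1, (F z).2).

End DiscreteHamiltonian.

Section Symplectic.
Context {R : realType} {N : nat}.

Definition wedge (a b : phase R N -> R) (u v : phase R N) : R :=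
  a u * b v - a v * b u.

Definition dq (i : 'I_N) (u : phase R N) : R := u.1 ord0 i.
Definition dp (i : 'I_N) (u : phase R N) : R := u.2 ord0 i.

Definition Omega (z u v : phase R N) : R :=
  \sum_(i < N) wedge (dq i) (dp i) u v.

Definition pullback (F : phase R N -> phase R N)
    (om : phase R N -> phase R N -> phase R N -> R) (z u v : phase R N) : R :=
  om (F z) ('d F z u) ('d F z v).

End Symplectic.

(* Main.v *)
Require Import Defs.
From HB Require Import structures.
From mathcomp Require Import all_boot all_order all_algebra.
From mathcomp Require Import all_classical all_reals all_analysis.
From mathcomp Require Import ring lra.

Set Implicit Arguments.
Unset Strict Implicit.
Unset Printing Implicit Defensive.

Import Order.TTheory GRing.Theory Num.Theory.
Import numFieldNormedType.Exports.

Local Open Scope classical_set_scope.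
Local Open Scope ring_scope.

(**
The values of the flow satisfy p_k = D_1 H_d^+ and q_{k+1} = D_2 H_d^+ at
(q_k, p_{k+1}).  Hence, for each outcome w, the function
G(z) = H_d^+(q_k, p_{k+1}(z)) of z = (q_k, p_k) is a potential of the 1-form
p_k dq_k + q_{k+1} dp_{k+1}.  If this form is closed then
dp_k /\ dq_k + dq_{k+1} /\ dp_{k+1} = 0, which is the symplecticity of
F : z |-> (q_{k+1}, p_{k+1}).  This holds for each w for which the hypotheses on
H_d^+ and F hold, that is almost surely; how H_d^+ arises as an extremal value
plays no role.

Since F is only C^1, the differential of p_{k+1} is only continuous, and G need
not be C^2; so the closedness is not the mere identity d(dG) = 0.  It is
obtained at a given point a as follows ([exact_form_closed]).  Let dG = sum_i A_i dB_i and
K = G - sum_i A_i(a) B_i.  Then D_w K = sum_i (A_i - A_i(a)) D_w B_i is a sum of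
products of a function differentiable and vanishing at a with a function
continuous at a; such products are differentiable at a
([is_diff_vanishingM]), so K is twice differentiable at a, with
D_v D_w K (a) = sum_i D_v A_i(a) D_w B_i(a).  The symmetry of second
derivatives, for functions twice differentiable at one point only
([derive_symmetric]), gives the claim.
*)

(** * Symmetry of second derivatives *)

Section SecondDerivative.
Context {R : realType} {V : normedModType R}.

Lemma is_derive_line (K : V -> R) (a u : V) (s : R) :
  derivable K (a + s *: u) u ->
  is_derive s 1 (fun s => K (a + s *: u)) ('D_u K (a + s *: u)).
Proof.
move=> dK; have E : (fun h : R => h^-1 *: (((fun s => K (a + s *: u)) \o shift s) (h *: 1)
     - K (a + s *: u))) =
   (fun h => h^-1 *: ((K \o shift (a + s *: u)) (h *: u) - K (a + s *: u))).
  apply/funext => h /=; congr (_ *: (K _ - _)).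
  by rewrite [h *: 1]mulr1 scalerDl addrCA.
by split; rewrite /derivable /derive E.
Qed.

(** The increment of K over the parallelogram with vertex a and sides t u, t v.
    It is symmetric in u and v, and equals t^2 D_v D_u K (a) up to o(t^2) if
    D_u K is differentiable at a. *)
Definition second_difference (K : V -> R) (a u v : V) (t : R) : R :=
  K (a + t *: v + t *: u) - K (a + t *: u) - K (a + t *: v) + K a.

Lemma second_differenceC (K : V -> R) (a u v : V) :
  second_difference K a u v = second_difference K a v u.
Proof.
by apply/funext => t; rewrite /second_difference (addrAC a); ring.
Qed.

(** The mean value theorem applied to the increment of K in the direction v,
    as a function of the displacement in the direction u. *)
Lemma second_difference_le (K : V -> R) (a u v : V) (e : R) : 0 < e ->
  (forall x, differentiable K x) -> differentiable ('D_u K) a ->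
  \forall t \near 0^'+,
    `|second_difference K a u v t - t ^+ 2 * 'D_v ('D_u K) a| <= e * t ^+ 2.
Proof.
move=> e0 dK dDK.
(* the summand 1 keeps M positive when u = v = 0 *)
set M := `|u| + `|v| + 1.
have M0 : 0 < M by rewrite ltr_wpDl// addr_ge0.
have e'0 : 0 < e / (2 * M) by rewrite divr_gt0// mulr_gt0.
have := diff_locally dDK => /eqaddoP /(_ _ e'0) /nbhs_ballP [dl /= dl0 Hdl].
near=> t.
have t0 : 0 < t by near: t; exact: nbhs_right_gt.
have tdl : t * M < dl.
  rewrite -ltr_pdivlMr//; near: t; apply: nbhs_right_lt.
  by rewrite divr_gt0.
pose phi (s : R) : R := K ((a + t *: v) + s *: u) - K (a + s *: u).
pose dphi (s : R) : R := 'D_u K ((a + t *: v) + s *: u) - 'D_u K (a + s *: u).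
have dphiE (s : R) : is_derive s 1 phi (dphi s).
  by apply: is_deriveB; apply: is_derive_line; exact: diff_derivable.
have phi_cont : {within `[0, t], continuous phi}.
  by apply: derivable_within_continuous => x _; case: (dphiE x).
have [s sin] := MVT t0 (fun x _ => dphiE x) phi_cont.
rewrite subr0 /phi !scale0r !addr0 => phiE.
have -> : second_difference K a u v t = dphi s * t.
  by rewrite -phiE /second_difference; ring.
have {}Hdl (h : V) : `|h| <= t * M ->
    `|'D_u K (a + h) - 'D_u K a - 'd ('D_u K) a h| <= e / 2 * t.
  move=> ht; have := Hdl h; rewrite -ball_normE /= sub0r normrN.
  move=> /(_ (le_lt_trans ht tdl)).
  rewrite -[X in `|X|]/('D_u K (h + a) - ('D_u K a + 'd ('D_u K) a h)).
  rewrite opprD addrA [h + a]addrC => /le_trans; apply.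
  apply: (@le_trans _ _ (e / (2 * M) * (t * M))); first by rewrite ler_wpM2l// ltW.
  by rewrite le_eqVlt; apply/orP; left; apply/eqP; field; rewrite gt_eqF.
move: sin; rewrite in_itv/= => /andP[s0 st].
have su : `|s *: u| <= t * `|u|.
  by rewrite normrZ gtr0_norm// ler_wpM2r// ltW.
have tv : `|t *: v| <= t * `|v| by rewrite normrZ gtr0_norm.
have h1 := Hdl (t *: v + s *: u).
have h2 := Hdl (s *: u).
have {}h1 := h1 ltac:(rewrite /M !mulrDr; have := ler_normD (t *: v) (s *: u); lra).
have {}h2 := h2 ltac:(rewrite /M !mulrDr; have := normr_ge0 (t *: v); lra).
rewrite (@deriveE _ _ _ ('D_u K))// /dphi -addrA.
have dtv : 'd ('D_u K) a (t *: v) = t *: 'd ('D_u K) a v by rewrite linearZ.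
move: h1 h2; rewrite linearD dtv.
set X : R := 'D_u K (a + _); set Y : R := 'D_u K (a + _); set Z : R := 'D_u K a.
set A : R := 'd _ a v; set B : R := 'd _ a _ => h1 h2.
have -> : (X - Y) * t - t ^+ 2 * A = t * ((X - Z - (t * A + B)) - (Y - Z - B)).
  by ring.
rewrite normrM gtr0_norm//.
rewrite (_ : e * t ^+ 2 = t * (e * t)); last by ring.
rewrite ler_wpM2l ?(ltW t0)//; apply: le_trans (ler_normB _ _) _; lra.
Unshelve. all: by end_near. Qed.

(** Second derivatives commute at a point where the first ones are
    differentiable, even if they are not continuous elsewhere (Young). *)
Lemma derive_symmetric (K : V -> R) (a u v : V) :
  (forall x, differentiable K x) ->
  differentiable ('D_u K) a -> differentiable ('D_v K) a ->
  'D_v ('D_u K) a = 'D_u ('D_v K) a.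
Proof.
move=> dK du dv; pose S := second_difference K a u v.
pose A : R := 'D_v ('D_u K) a; pose B : R := 'D_u ('D_v K) a.
have HA e : 0 < e ->
    \forall t \near (0 : R)^'+, `|S t - t ^+ 2 * A| <= e * t ^+ 2.
  by move=> e0; exact: second_difference_le.
have HB e : 0 < e ->
    \forall t \near (0 : R)^'+, `|S t - t ^+ 2 * B| <= e * t ^+ 2.
  by move=> e0; rewrite /S second_differenceC; exact: second_difference_le.
rewrite -[LHS]/A -[RHS]/B; clearbody A B S.
apply/eqP; rewrite -subr_eq0 -normr_le0.
apply/ler_addgt0Pr => e e0; rewrite add0r.
have e20 : 0 < e / 2 by rewrite divr_gt0.
near (0 : R)^'+ => t.
have t20 : 0 < t ^+ 2 by rewrite exprn_gt0.
have h1 : `|S t - t ^+ 2 * A| <= e / 2 * t ^+ 2 by near: t; exact: HA.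
have h2 : `|S t - t ^+ 2 * B| <= e / 2 * t ^+ 2 by near: t; exact: HB.
rewrite -(ler_pM2l t20) -[X in X * `|_|](gtr0_norm t20) -normrM.
have -> : t ^+ 2 * (A - B) = (S t - t ^+ 2 * B) - (S t - t ^+ 2 * A) by ring.
by have := ler_normB (S t - t ^+ 2 * B) (S t - t ^+ 2 * A); lra.
Unshelve. all: by end_near. Qed.

(** The derivative of g does not occur in the product rule, as f vanishes at a:
    so continuity of g suffices. *)
Lemma is_diff_vanishingM (f g : V -> R) (a : V) :
  differentiable f a -> f a = 0 -> {for a, continuous g} ->
  is_diff a (f * g) (g a \*: 'd f a).
Proof.
move=> df fa0 cg.
have step : continuous (g a \*: 'd f a) /\
    (f * g) \o shift a = cst ((f * g) a) + (g a \*: 'd f a) +o_ 0 id.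
  split.
    by move=> x; apply: continuousZl_tmp; exact: diff_continuous.
  apply/eqaddoP; move=> /= e e0.
  have /= [C C0 HC] := linear_lipschitz (diff_continuous df).
  have e1 : 0 < e / 2 / (C + 1) by rewrite !divr_gt0// addr_gt0.
  have e2 : 0 < e / 2 / (`|g a| + 1) by rewrite !divr_gt0// ltr_wpDl.
  have := diff_locally df => /eqaddoP /[dup] /(_ _ ltr01) H1 /(_ _ e2) H2.
  have : \forall h \near (0 : V), `|g (h + a) - g a| <= e / 2 / (C + 1).
    have := cg => /cvgrPdist_le /(_ _ e1) H.
    rewrite (near_shift a); apply: filterS H => x /=.
    by rewrite sub0r subrK distrC.
  move: H1 H2; apply: filterS3 => h.
  rewrite -[X in `|X| <= 1 * _]/(f (h + a) - (f a + 'd f a h)).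
  rewrite -[X in `|X| <= _ / _ / _ * _]/(f (h + a) - (f a + 'd f a h)).
  rewrite -[X in _ -> _ -> _ -> `|X| <= _]/
    (f (h + a) * g (h + a) - (f a * g a + g a * 'd f a h)).
  rewrite fa0 mul0r !add0r mul1r [`|id h|]/`|h|.
  pose n : R := `|h|; pose D : R := 'd f a h.
  pose y : R := f (h + a); pose dg : R := g (h + a) - g a => h1 h2 h3.
  have hD : `|D| <= C * n := HC h.
  have {}h1 : `|y - D| <= n := h1.
  have {}h2 : `|y - D| <= e / 2 / (`|g a| + 1) * n := h2.
  have {}h3 : `|dg| <= e / 2 / (C + 1) := h3.
  suff: `|y * g (h + a) - g a * D| <= e * n by [].
  (* h3 bounds the first summand below, as |y| <= (C + 1) n, and h2 the second *)
  have -> : y * g (h + a) - g a * D = y * dg + g a * (y - D).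
    by rewrite /dg; ring.
  have n0 : 0 <= n by exact: normr_ge0.
  have hy : `|y| <= (C + 1) * n.
    have := ler_normD (y - D) D; rewrite subrK; lra.
  have h4 : `|y * dg| <= e / 2 * n.
    rewrite normrM; apply: le_trans (ler_pM _ _ hy h3) _ => //.
    rewrite le_eqVlt; apply/orP; left; apply/eqP; field.
    by rewrite gt_eqF// addr_gt0.
  have h5 : `|g a * (y - D)| <= e / 2 * n.
    rewrite normrM; apply: le_trans (ler_wpM2l _ h2) _ => //.
    have ga1 : 0 < `|g a| + 1 by rewrite ltr_wpDl.
    rewrite (_ : e / 2 * n = (`|g a| + 1) * (e / 2 / (`|g a| + 1) * n)).
      by rewrite ler_wpM2r ?lerDl// mulr_ge0// ltW.
    by field; rewrite gt_eqF.
  by apply: le_trans (ler_normD _ _) _; lra.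
have [sc so] := step; have E := @diff_unique _ _ _ (f * g) (g a \*: 'd f a) a sc so.
apply: DiffDef; last exact: E.
by apply/diff_locallyP; rewrite E.
Qed.

(** * Closedness of an exact form *)

Lemma is_diff_derive (W : normedModType R) (f df : V -> W) (x w : V) :
  is_diff x f df -> 'D_w f x = df w.
Proof. by move=> ?; rewrite deriveE// diff_val. Qed.

Lemma is_diff_sum (I : finType) (f df : I -> V -> R) (x : V) :
  (forall i, is_diff x (f i) (df i)) ->
  is_diff x (\sum_i f i) (\sum_i df i).
Proof.
move=> fdf; elim/big_ind2 : _ => [|f1 df1 f2 df2 h1 h2|i _]; last exact: fdf.
  exact: is_diff_cst.
exact: is_diffD.
Qed.

(** The 1-form dG = sum_i A_i dB_i is closed at a:
    sum_i dA_i /\ dB_i = 0.  The A_i need only be differentiable at a and the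
    D_w B_i continuous at a, so that G itself need not be C^2. *)
Lemma exact_form_closed (I : finType) (G : V -> R) (A B : I -> V -> R)
    (a u v : V) :
  (forall x, differentiable G x) -> (forall i x, differentiable (B i) x) ->
  (forall i, differentiable (A i) a) ->
  (forall i w, {for a, continuous ('D_w (B i))}) ->
  (forall x w, 'D_w G x = \sum_i A i x * 'D_w (B i) x) ->
  \sum_i 'D_u (A i) a * 'D_v (B i) a = \sum_i 'D_v (A i) a * 'D_u (B i) a.
Proof.
move=> dG dB dA cB GE; pose K := G - \sum_i A i a *: B i.
have dK x : is_diff x K (('d G x : V -> R) - \sum_i A i a *: ('d (B i) x : V -> R)).
  apply: is_diffB; first exact: differentiableP.
  by apply: is_diff_sum => i; apply: is_diffZ; exact: differentiableP.
have DK w : 'D_w K = \sum_i (A i - cst (A i a)) * 'D_w (B i).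
  apply/funext => x; have dKx := dK x; rewrite deriveE// diff_val.
  rewrite [LHS]/('d G x w - (\sum_i A i a *: ('d (B i) x : V -> R)) w).
  rewrite -deriveE// GE !fct_sumE.
  apply: (eq_trans (esym (sumrB _ _ _ _))); apply: eq_bigr => i _.
  rewrite -[(_ *: _) w]/(A i a * 'd (B i) x w) -deriveE//.
  by rewrite -mulrBl.
have dDK w : is_diff a ('D_w K) (\sum_i 'D_w (B i) a *: ('d (A i) a : V -> R)).
  rewrite DK; apply: is_diff_sum => i.
  have dAi : is_diff a (A i - cst (A i a)) ('d (A i) a).
    have := is_diffB (differentiableP (dA i)) (is_diff_cst (A i a) a).
    by rewrite subr0.
  rewrite -(@diff_val _ _ _ _ _ _ _ dAi); apply: is_diff_vanishingM => //.
  by rewrite [LHS]subrr.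
have DDK w w' : 'D_w' ('D_w K) a = \sum_i 'D_w' (A i) a * 'D_w (B i) a.
  rewrite deriveE// diff_val fct_sumE; apply: eq_bigr => i _.
  by rewrite [RHS]mulrC (deriveE _ (dA i)).
rewrite -!DDK; apply: derive_symmetric => //.
Qed.
End SecondDerivative.

(** * Phase space and the discrete flow *)

Section PhaseSpace.
Context {R : realType} {N : nat}.

Lemma is_diff_linear (V W : normedModType R) (f : V -> W) (x : V) :
  linear f -> continuous f -> is_diff x f f.
Proof.
move=> lf cf; pose fM := GRing.isLinear.Build _ _ _ _ _ lf.
pose fL : {linear V -> W} := HB.pack f fM.
by split; [exact: (@linear_differentiable _ _ _ fL)|exact: (@diff_lin _ _ _ fL)].
Qed.

Lemma is_diff_dq (i : 'I_N) (z : phase R N) : is_diff z (dq i) (dq i).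
Proof.
apply: is_diff_linear => [k x y|x]; first by rewrite /dq/= !mxE.
by apply: (@continuous_comp _ _ _ fst (fun M : 'rV[R]_N => M ord0 i));
  [exact: cvg_fst|exact: coord_continuous].
Qed.

Lemma is_diff_dp (i : 'I_N) (z : phase R N) : is_diff z (dp i) (dp i).
Proof.
apply: is_diff_linear => [k x y|x]; first by rewrite /dp/= !mxE.
by apply: (@continuous_comp _ _ _ snd (fun M : 'rV[R]_N => M ord0 i));
  [exact: cvg_snd|exact: coord_continuous].
Qed.

Lemma D1E (f : phase R N -> R) z i : differentiable f z ->
  D1 f z ord0 i = 'd f z (delta_mx ord0 i, 0).
Proof.
move=> df; rewrite -deriveE// !mxE /derive.
apply: (congr1 (fun g : R -> R => lim (g h @[h --> 0^']))).
apply/funext => h; case: z {df} => q p /=; congr (_ *: (f (_, _) - _)).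
by rewrite [RHS]/= scaler0 add0r.
Qed.

Lemma D2E (f : phase R N -> R) z i : differentiable f z ->
  D2 f z ord0 i = 'd f z (0, delta_mx ord0 i).
Proof.
move=> df; rewrite -deriveE// !mxE /derive.
apply: (congr1 (fun g : R -> R => lim (g h @[h --> 0^']))).
apply/funext => h; case: z {df} => q p /=; congr (_ *: (f (_, _) - _)).
by rewrite [RHS]/= scaler0 add0r.
Qed.

Lemma phase_basis (w : phase R N) :
  w = \sum_i dq i w *: (delta_mx ord0 i, 0) +
      \sum_i dp i w *: (0, delta_mx ord0 i).
Proof.
have add1 (x y : phase R N) : (x + y).1 = x.1 + y.1 by [].
have add2 (x y : phase R N) : (x + y).2 = x.2 + y.2 by [].
case: w => q p; rewrite [RHS]surjective_pairing; congr (_, _).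
  rewrite add1 !(big_morph fst add1 erefl) [X in _ + X]big1 ?addr0.
    exact: row_sum_delta.
  by move=> i _; rewrite /= scaler0.
rewrite add2 !(big_morph snd add2 erefl) big1 ?add0r.
  exact: row_sum_delta.
by move=> i _; rewrite /= scaler0.
Qed.

Lemma diff_phase (f : phase R N -> R) z w : differentiable f z ->
  'd f z w = \sum_i D1 f z ord0 i * dq i w + \sum_i D2 f z ord0 i * dp i w.
Proof.
move=> df; rewrite {1}(phase_basis w) linearD !linear_sum.
congr (_ + _); apply: eq_bigr => i _.
  by rewrite linearZ D1E// [RHS]mulrC.
by rewrite linearZ D2E// [RHS]mulrC.
Qed.

(** A C^1 map F : (q, p) |-> (Q, P) is symplectic if it has a differentiable
    generating function Hd(q, P), that is p = D_1 Hd and Q = D_2 Hd at (q, P). *)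
Lemma discrete_flow_symplectic (Hd : phase R N -> R) (F : phase R N -> phase R N) :
  (forall x, differentiable Hd x) -> C1 F -> is_discrete_flow Hd F ->
  pullback F Omega = Omega.
Proof.
move=> dHd [dF cF] flow.
apply/funext => z; apply/funext => u; apply/funext => v.
have dqF i x : is_diff x (dq i \o F) (dq i \o 'd F x).
  have ? := differentiableP (dF x); have ? := is_diff_dq i (F x).
  exact: is_diff_comp.
have dpF i x : is_diff x (dp i \o F) (dp i \o 'd F x).
  have ? := differentiableP (dF x); have ? := is_diff_dp i (F x).
  exact: is_diff_comp.
(* in the context for the inference of [is_diff] instances *)
have dqd := @is_diff_dq; have dpd := @is_diff_dp.
(* dG = p_k dq_k + q_{k+1} dp_{k+1}, with coefficients A and functions B *)
pose A (i : 'I_N + 'I_N) : phase R N -> R :=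
  match i with inl i => dp i | inr i => dq i \o F end.
pose B (i : 'I_N + 'I_N) : phase R N -> R :=
  match i with inl i => dq i | inr i => dp i \o F end.
pose m (x : phase R N) : phase R N := (x.1, (F x).2).
pose G := Hd \o m.
have dm x : is_diff x m (fun w => (w.1, ('d F x w).2)).
  have dFx := differentiableP (dF x).
  have d1 : is_diff x (fst : phase R N -> _) fst.
    by apply: is_diff_linear => // y; exact: cvg_fst.
  have d2 : is_diff (F x) (snd : phase R N -> _) snd.
    by apply: is_diff_linear => // y; exact: cvg_snd.
  by apply: is_diff_pair; exact: is_diff_comp.
have dG x : is_diff x G ('d Hd (m x) \o (fun w => (w.1, ('d F x w).2))).
  have ? := differentiableP (dHd (m x)); exact: is_diff_comp.
have Dq (i : 'I_N) (x w : phase R N) : 'D_w (dq i) x = dq i w.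
  exact: (is_diff_derive _ (is_diff_dq i x)).
have Dp (i : 'I_N) (x w : phase R N) : 'D_w (dp i) x = dp i w.
  exact: (is_diff_derive _ (is_diff_dp i x)).
have DqF i x w : 'D_w (dq i \o F) x = dq i ('d F x w).
  exact: (is_diff_derive _ (dqF i x)).
have DpF i x w : 'D_w (dp i \o F) x = dp i ('d F x w).
  exact: (is_diff_derive _ (dpF i x)).
have closed : \sum_i 'D_u (A i) z * 'D_v (B i) z = \sum_i 'D_v (A i) z * 'D_u (B i) z.
  apply: (@exact_form_closed _ _ _ G).
  - by [].
  - by case.
  - by case.
  - case=> i w /=.
      rewrite (_ : 'D_w (dq i) = cst (dq i w)); first exact: cst_continuous.
      by apply/funext => x; rewrite Dq.
    rewrite (_ : 'D_w (dp i \o F) = dp i \o 'D_w F).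
      apply: continuous_comp; first exact: cF.
      exact: differentiable_continuous.
    by apply/funext => x; rewrite DpF /= deriveE.
  - move=> x w; have [Fq Fp] := flow x.
    rewrite (is_diff_derive _ (dG x)) [LHS]/= diff_phase// big_sumType /=.
    congr (_ + _); apply: eq_bigr => i _.
      by rewrite Dq /m -Fp.
    by rewrite DpF /m -Fq.
move: closed; rewrite !big_sumType /=.
under eq_bigr do rewrite Dp Dq.
under [X in _ + X = _]eq_bigr do rewrite DqF DpF.
under [X in _ = X + _]eq_bigr do rewrite Dp Dq.
under [X in _ = _ + X]eq_bigr do rewrite DqF DpF.
under eq_bigr do rewrite mulrC; under [X in _ = X + _]eq_bigr do rewrite mulrC.
by move=> closed; rewrite /pullback /Omega /wedge !sumrB; lra.
Qed.

End PhaseSpace.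

Theorem theorem3p1 (R : realType) (N : nat)
  (d : measure_display) (T : measurableType d) (P : probability T R)
  (Filt : R -> set (set T)) (W : R -> T -> R)
  (H h : phase R N -> R)
  (s : nat) (cp : 'I_s.+1 -> R)
  (r : nat) (alpha beta c : 'I_r -> R)
  (dt : R) (k : nat)
  (Hd : T -> phase R N -> R) (F : T -> phase R N -> phase R N)
  (hW : wiener P Filt W)
  (hH : C2 H) (hh : C2 h)
  (hA : lipschitz (ito_drift H h)) (hB : lipschitz (ito_diffusion h))
  (hs : (0 < s)%N)
  (hcp0 : cp ord0 = 0) (hcp1 : cp ord_max = 1)
  (hcp : forall mu nu : 'I_s.+1, (mu < nu)%N -> cp mu < cp nu)
  (hr : (0 < r)%N)
  (hc01 : forall i, 0 <= c i <= 1)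
  (hc : forall i j : 'I_r, (i < j)%N -> c i < c j)
  (hab : forall i, alpha i != 0 \/ beta i != 0)
  (hdt : 0 < dt)
  (hHd : \forall w \ae P,
     is_discrete_hamiltonian H h cp alpha beta c dt
       (increment W (k%:R * dt) (k.+1%:R * dt) w) (Hd w))
  (* so that D1 and D2 of Hd make sense *)
  (hHdD : \forall w \ae P, forall x, differentiable (Hd w) x)
  (hF : \forall w \ae P, is_discrete_flow (Hd w) (F w))
  (* so that the pullback by F makes sense *)
  (hFC : \forall w \ae P, C1 (F w)) :
  \forall w \ae P, pullback (F w) Omega = Omega.
Proof.
near=> w; apply: (@discrete_flow_symplectic _ _ (Hd w)).
- by near: w.
- by near: w.
- by near: w.
Unshelve. all: by end_near. Qed.
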